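(* For $i\ge 2$ let $a_i(t) := \frac{d}{dt}[i]_t = \sum_{j=0}^{i-2}(j+1)t^j$, $b_i(t) := t^{i-1}a_i(t^{-1}) = \sum_{j=1}^{i-1}(i-j)t^j$, and $c_i(t) := i\,t\,[i-2]_t$. Let $D(\mathbf{x},t,z) := 1-\sum_{i\ge 2} t[i-1]_t\, e_i(\mathbf{x}) z^i$. Then, as formal power series in $z$, $$\sum_{n\ge 1} W^<_n(\mathbf{x},t) z^n = \frac{1}{D(\mathbf{x},t,z)}\sum_{i\ge 2} a_i(t)\, e_i(\mathbf{x}) z^i,$$ $$\sum_{n\ge 1} W^>_n(\mathbf{x},t) z^n = \frac{1}{D(\mathbf{x},t,z)}\sum_{i\ge 2} b_i(t)\, e_i(\mathbf{x}) z^i,$$ $$\sum_{n\ge 1} W^=_n(\mathbf{x},t) z^n = \frac{1}{D(\mathbf{x},t,z)}\Big(e_1(\mathbf{x}) z-\sum_{i\ge 2} c_i(t)\, e_i(\mathbf{x}) z^i\Big).$$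
   Context: For $n\ge 1$, $W_n$ is the set of Smirnov words of length $n$: words $w=w_1\cdots w_n$ over the positive integers with $w_i\ne w_{i+1}$ for all $1\le i\le n-1$. Let $\mathbf{x}=x_1,x_2,\dots$ be indeterminates and $x_w:=x_{w_1}\cdots x_{w_n}$. The descent number is $\mathrm{des}(w):=|\{i\in\{1,\dots,n-1\}: w_i>w_{i+1}\}|$. Define $W^<_n(\mathbf{x},t)$, $W^>_n(\mathbf{x},t)$, $W^=_n(\mathbf{x},t)$ to be $\sum t^{\mathrm{des}(w)}x_w$, the sum being over all $w\in W_n$ with $w_1<w_n$, $w_1>w_n$, $w_1=w_n$, respectively. Here $e_i(\mathbf{x})$ is the elementary symmetric function of degree $i$, and $[m]_t:=1+t+\cdots+t^{m-1}$, with $[0]_t=0$. *)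

(* Defs.v *)
From HB Require Import structures.
From mathcomp Require Import all_boot all_order all_algebra fraction.
From mathcomp Require Import finmap monalg.
From mathcomp Require Import boolp classical_sets functions cardinality fsbigop.

Set Implicit Arguments.
Unset Strict Implicit.
Unset Printing Implicit Defensive.

Import GRing.Theory.
Local Open Scope ring_scope.

(* Formal power series in one variable.  These are records rather than bare   *)
(* functions, which would inherit a pointwise product.                        *)
Record fps (A : Type) := FPS { fps_coef : nat -> A }.

Notation "{ 'fps' A }" := (fps A) (at level 0, format "{ 'fps'  A }").

Section FPSRing.
Variable A : comNzRingType.
Implicit Types f g h : {fps A}.

HB.instance Definition _ := gen_eqMixin {fps A}.
HB.instance Definition _ := gen_choiceMixin {fps A}.

Lemma fpsP f g : (forall n, fps_coef f n = fps_coef g n) -> f = g.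
Proof. by case: f g => [f] [g] /= fg; congr FPS; apply/funext. Qed.

Definition fps_zero : {fps A} := FPS (fun=> 0).
Definition fps_opp f : {fps A} := FPS (fun n => - fps_coef f n).
Definition fps_add f g : {fps A} := FPS (fun n => fps_coef f n + fps_coef g n).
Definition fps_one : {fps A} := FPS (fun n => (n == 0%N)%:R).
Definition fps_mul f g : {fps A} :=
  FPS (fun n => \sum_(i < n.+1) fps_coef f i * fps_coef g (n - i)%N).

Fact fps_addA : associative fps_add.
Proof. by move=> f g h; apply/fpsP => n /=; rewrite addrA. Qed.
Fact fps_addC : commutative fps_add.
Proof. by move=> f g; apply/fpsP => n /=; rewrite addrC. Qed.
Fact fps_add0 : left_id fps_zero fps_add.
Proof. by move=> f; apply/fpsP => n /=; rewrite add0r. Qed.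
Fact fps_addN : left_inverse fps_zero fps_opp fps_add.
Proof. by move=> f; apply/fpsP => n /=; rewrite addNr. Qed.

HB.instance Definition _ :=
  GRing.isZmodule.Build {fps A} fps_addA fps_addC fps_add0 fps_addN.

Fact fps_coef_mul_rev f g n : fps_coef (fps_mul f g) n =
  \sum_(i < n.+1) fps_coef f (n - i)%N * fps_coef g i.
Proof.
rewrite /= (reindex_inj rev_ord_inj) /=; apply: eq_bigr => i _.
by rewrite (subKn (leq_ord i)).
Qed.

Fact fps_coef_mul f g n : fps_coef (fps_mul f g) n =
  \sum_(i < n.+1) fps_coef f i * fps_coef g (n - i)%N.
Proof. by []. Qed.

Fact fps_mulC : commutative fps_mul.
Proof.
move=> f g; apply/fpsP => n; rewrite fps_coef_mul_rev /=.
by apply: eq_bigr => i _; rewrite mulrC.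
Qed.

Fact fps_mulA : associative fps_mul.
Proof.
move=> p q r; apply/fpsP => i; rewrite fps_coef_mul fps_coef_mul_rev.
pose coef3 j k := fps_coef p j * (fps_coef q (i - j - k)%N * fps_coef r k).
transitivity (\sum_(j < i.+1) \sum_(k < i.+1 | (k <= i - j)%N) coef3 j k).
  apply: eq_bigr => j _.
  rewrite fps_coef_mul_rev big_distrr /=.
  by rewrite (big_ord_narrow_leq (leq_subr _ _)).
rewrite (exchange_big_dep predT) //; apply: eq_bigr => k _.
transitivity (\sum_(j < i.+1 | (j <= i - k)%N) coef3 j k).
  apply: eq_bigl => j; rewrite -ltnS -(ltnS j) -!subSn ?leq_ord //.
  by rewrite -subn_gt0 -(subn_gt0 j) -!subnDA addnC.
rewrite (big_ord_narrow_leq (leq_subr _ _)) fps_coef_mul big_distrl /=.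
by apply: eq_bigr => j _; rewrite /coef3 -!subnDA addnC mulrA.
Qed.

Fact fps_mul1 : left_id fps_one fps_mul.
Proof.
move=> f; apply/fpsP => n /=; rewrite big_ord_recl subn0 mul1r.
by rewrite big1 ?addr0 // => i _; rewrite mul0r.
Qed.

Fact fps_mulDl : left_distributive fps_mul fps_add.
Proof.
move=> f g h; apply/fpsP => n /=; rewrite -big_split /=.
by apply: eq_bigr => i _; rewrite mulrDl.
Qed.

Fact fps_one_neq0 : fps_one != 0.
Proof.
by apply/eqP => /(congr1 (fun f => fps_coef f 0%N)) /eqP; rewrite /= oner_eq0.
Qed.

HB.instance Definition _ := GRing.Zmodule_isComNzRing.Build {fps A}
  fps_mulA fps_mulC fps_mul1 fps_mulDl fps_one_neq0.

Lemma fps_coef0 n : fps_coef (0 : {fps A}) n = 0. Proof. by []. Qed.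
Lemma fps_coef1 n : fps_coef (1 : {fps A}) n = (n == 0%N)%:R.
Proof. by []. Qed.
Lemma fps_coefN f n : fps_coef (- f) n = - fps_coef f n. Proof. by []. Qed.
Lemma fps_coefD f g n : fps_coef (f + g) n = fps_coef f n + fps_coef g n.
Proof. by []. Qed.
Lemma fps_coefM f g n :
  fps_coef (f * g) n = \sum_(i < n.+1) fps_coef f i * fps_coef g (n - i)%N.
Proof. by []. Qed.

Definition fps_unit : pred {fps A} := fun f => `[< exists g, g * f = 1 >].
Definition fps_inv f : {fps A} :=
  if pselect (exists g, g * f = 1) is left fU then projT1 (cid fU) else f.

Fact fps_mulV : {in fps_unit, left_inverse 1 fps_inv *%R}.
Proof.
move=> f /asboolP fU; rewrite /fps_inv; case: pselect => // fU'.
exact: projT2 (cid fU').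
Qed.
Fact fps_unitP f g : g * f = 1 -> fps_unit f.
Proof. by move=> gf; apply/asboolP; exists g. Qed.
Fact fps_inv_out : {in [predC fps_unit], fps_inv =1 id}.
Proof.
by move=> f /asboolP fNU; rewrite /fps_inv; case: pselect.
Qed.

HB.instance Definition _ := GRing.ComNzRing_hasMulInverse.Build {fps A}
  fps_mulV fps_unitP fps_inv_out.

Lemma fps_unit1 f : fps_coef f 0 = 1 -> f \is a GRing.unit.
Proof.
move=> f0.
pose step (s : seq A) :=
  rcons s ((size s == 0%N)%:R
           - \sum_(i < size s) s`_i * fps_coef f (size s - i)%N).
pose s n := iter n step [::].
have sz n : size (s n) = n by elim: n => //= n IH; rewrite size_rcons IH.
pose g : {fps A} := FPS (fun n => (s n.+1)`_n).
have nths m n : (n < m)%N -> (s m)`_n = fps_coef g n.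
  elim: m => // m IH; rewrite ltnS leq_eqVlt => /orP[/eqP->//|nm].
  by rewrite /= nth_rcons sz nm IH.
apply/asboolP; exists g; apply/fpsP => n.
rewrite fps_coefM big_ord_recr /= subnn f0 mulr1.
rewrite -/(s n) /step nth_rcons sz ltnn eqxx.
rewrite (eq_bigr (fun i : 'I_n => (s n)`_i * fps_coef f (n - i)%N)).
  by rewrite addrC subrK.
by move=> i _; rewrite nths.
Qed.

Definition fpsC (c : A) : {fps A} := FPS (fun n => if n == 0%N then c else 0).
Definition fpsX : {fps A} := FPS (fun n => (n == 1%N)%:R).

(* sum_(n >= k) c_n z^n *)
Definition fps_from (k : nat) (c : nat -> A) : {fps A} :=
  FPS (fun n => if (k <= n)%N then c n else 0).

End FPSRing.

Arguments fpsX {A}.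

(* Formal power series, of possibly unbounded degree, in the commuting        *)
(* variables x_i (i : I), where I may be infinite: arbitrary functions on the *)
(* monomials with finite support.                                             *)
Record mfps (I : choiceType) (R : Type) := MFPS { mfps_coef : {cmonom I} -> R }.

Section MonomialDivisors.
Variable I : choiceType.
Implicit Types m a b : {cmonom I}.

Lemma cmonom_le a b m : mmul a b = m -> forall i, (a i <= m i)%N.
Proof. by move=> <- i; rewrite cmM leq_addr. Qed.

Lemma finite_cmonom_le m :
  finite_set [set a : {cmonom I} | forall i, (a i <= m i)%N].
Proof.
pose N := (\sum_(i <- finsupp m) m i)%N.
pose F (u : {ffun finsupp m -> 'I_N.+1}) : {cmonom I} :=
  mkcmonom [fsfun i : finsupp m => (u i : nat) | 0%N].
apply: (@sub_finite_set _ _ (F @` setT)); last first.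
  by apply: finite_image; apply: finite_finset.
move=> a le_am; exists [ffun i : finsupp m => inord (a (val i))] => //.
apply/eqP/cmP => i; rewrite /F cmE fsfun_ffun.
case: insubP => [u _ <-|iNm] /=.
  rewrite ffunE inordK // ltnS (leq_trans (le_am _)) // /N.
  by rewrite (big_fsetD1 (val u)) ?valP //= leq_addr.
move: (le_am i); rewrite (fsfun_dflt iNm) leqn0 => /eqP->.
by [].
Qed.

Lemma finite_cmonom_factor m :
  finite_set [set p : {cmonom I} * {cmonom I} | mmul p.1 p.2 = m].
Proof.
have fm := finite_cmonom_le m.
apply: sub_finite_set (finite_setX fm fm) => -[a b] /= abm; split=> /=.
  exact: cmonom_le abm.
by move: abm; rewrite mulmC; exact: cmonom_le.
Qed.

Definition mdivisors m : {fset {cmonom I}} :=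
  fset_set [set a : {cmonom I} | forall i, (a i <= m i)%N].

Lemma mem_mdivisors m a : reflect (forall i, (a i <= m i)%N) (a \in mdivisors m).
Proof.
rewrite /mdivisors in_fset_set; last exact: finite_cmonom_le.
by apply: (iffP idP) => [/set_mem //|le_am]; apply: mem_set.
Qed.

End MonomialDivisors.


Section MFPSRing.
Variables (I : choiceType) (R : comNzRingType).
Local Notation mfps := (mfps I R).
Implicit Types (f g h : mfps) (m a b : {cmonom I}).

HB.instance Definition _ := gen_eqMixin mfps.
HB.instance Definition _ := gen_choiceMixin mfps.

Lemma mfpsP f g : (forall m, mfps_coef f m = mfps_coef g m) -> f = g.
Proof. by case: f g => [f] [g] /= fg; congr MFPS; apply/funext. Qed.

Definition mfps_zero : mfps := MFPS (fun=> 0).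
Definition mfps_opp f : mfps := MFPS (fun m => - mfps_coef f m).
Definition mfps_add f g : mfps :=
  MFPS (fun m => mfps_coef f m + mfps_coef g m).
Definition mfps_one : mfps := MFPS (fun m => (m == mone)%:R).
(* The index set is finite by finite_cmonom_factor.                           *)
Definition mfps_mul f g : mfps :=
  MFPS (fun m => \sum_(p \in [set p : {cmonom I} * {cmonom I} |
                                mmul p.1 p.2 = m])
                    mfps_coef f p.1 * mfps_coef g p.2).
Definition mfps_scale (c : R) f : mfps := MFPS (fun m => c * mfps_coef f m).

Fact mfps_addA : associative mfps_add.
Proof. by move=> f g h; apply/mfpsP => m /=; rewrite addrA. Qed.
Fact mfps_addC : commutative mfps_add.
Proof. by move=> f g; apply/mfpsP => m /=; rewrite addrC. Qed.
Fact mfps_add0 : left_id mfps_zero mfps_add.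
Proof. by move=> f; apply/mfpsP => m /=; rewrite add0r. Qed.
Fact mfps_addN : left_inverse mfps_zero mfps_opp mfps_add.
Proof. by move=> f; apply/mfpsP => m /=; rewrite addNr. Qed.

HB.instance Definition _ :=
  GRing.isZmodule.Build mfps mfps_addA mfps_addC mfps_add0 mfps_addN.

Fact mfps_coef_mul (s : {fset {cmonom I}}) f g m :
    {subset mdivisors m <= s} ->
  mfps_coef (mfps_mul f g) m =
  \sum_(a <- s) \sum_(b <- s)
    (if mmul a b == m then mfps_coef f a * mfps_coef g b else 0).
Proof.
move=> sub_s; rewrite /= (fsbig_finite _ _ (finite_cmonom_factor m)) /=.
transitivity (\sum_(p <- [seq (a, b) | a <- s, b <- s])
    if mmul p.1 p.2 == m then mfps_coef f p.1 * mfps_coef g p.2 else 0);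
  last by rewrite big_allpairs.
rewrite -[RHS]big_mkcond /= -[RHS]big_filter.
apply/perm_big/uniq_perm; first exact: fset_uniq.
  by rewrite filter_uniq // allpairs_uniq ?fset_uniq // => -[? ?] [].
move=> [a b]; rewrite in_fset_set; last exact: finite_cmonom_factor.
rewrite mem_filter /= ; apply/idP/andP => [/set_mem /= abm|[/eqP abm _]].
  split; first exact/eqP.
  apply/allpairsP; exists (a, b); split=> //=; apply/sub_s/mem_mdivisors.
    exact: cmonom_le abm.
  by move: abm; rewrite mulmC; apply: cmonom_le.
exact/mem_set.
Qed.

Fact mfps_mulC : commutative mfps_mul.
Proof.
move=> f g; apply/mfpsP => m; rewrite !(@mfps_coef_mul (mdivisors m)) //.
rewrite exchange_big; apply: eq_bigr => a _; apply: eq_bigr => b _.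
by rewrite mulmC mulrC.
Qed.

Let mdivisors_sub m a : a \in mdivisors m -> {subset mdivisors a <= mdivisors m}.
Proof.
move=> /mem_mdivisors am b /mem_mdivisors ba; apply/mem_mdivisors => i.
exact: leq_trans (ba i) (am i).
Qed.

Let mdivisors_mull a b m : mmul a b = m -> a \in mdivisors m.
Proof. by move=> abm; apply/mem_mdivisors; exact: cmonom_le abm. Qed.

Fact mfps_coef_mul3 f g h m : mfps_coef (mfps_mul (mfps_mul f g) h) m =
  \sum_(a <- mdivisors m) \sum_(b <- mdivisors m) \sum_(c <- mdivisors m)
    (if mmul (mmul a b) c == m
     then mfps_coef f a * mfps_coef g b * mfps_coef h c else 0).
Proof.
set s := mdivisors m; rewrite (@mfps_coef_mul s) //.
transitivity (\sum_(d <- s) \sum_(c <- s) \sum_(a <- s) \sum_(b <- s)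
   (if (mmul a b == d) && (mmul d c == m)
    then mfps_coef f a * mfps_coef g b * mfps_coef h c else 0)).
  rewrite !big_seq; apply: eq_bigr => d ds; apply: eq_bigr => c _.
  rewrite (mfps_coef_mul _ _ (mdivisors_sub ds)).
  case: eqP => _; last by rewrite big1 // => a _; rewrite big1 // => b _; rewrite andbF.
  rewrite big_distrl; apply: eq_bigr => a _ /=.
  rewrite big_distrl; apply: eq_bigr => b _ /=.
  by rewrite andbT; case: ifP; rewrite ?mul0r.
under eq_bigr do rewrite exchange_big.
rewrite exchange_big; apply: eq_bigr => a _.
under eq_bigr do rewrite exchange_big.
rewrite exchange_big; apply: eq_bigr => b _.
rewrite exchange_big; apply: eq_bigr => c _.
have [abcm|abcNm] := eqVneq (mmul (mmul a b) c) m; last first.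
  rewrite big1 // => d _; case: eqP => //= <-.
  by rewrite (negbTE abcNm).
rewrite (bigD1_seq (mmul a b)) ?fset_uniq //=; last exact: mdivisors_mull abcm.
rewrite eqxx abcm eqxx big1 ?addr0 // => d; rewrite eq_sym => /negbTE->.
by [].
Qed.

Fact mfps_mulA : associative mfps_mul.
Proof.
move=> f g h; apply/mfpsP => m; rewrite [mfps_mul f _]mfps_mulC !mfps_coef_mul3.
under eq_bigr do rewrite exchange_big.
rewrite exchange_big; apply: eq_bigr => a _.
apply: eq_bigr => b _; apply: eq_bigr => c _.
have -> : mmul (mmul b c) a = mmul (mmul a b) c by rewrite mulmC mulmA.
by rewrite [mfps_coef g b * _ * _]mulrC mulrA.
Qed.

Fact mfps_mul1 : left_id mfps_one mfps_mul.
Proof.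
move=> f; apply/mfpsP => m; rewrite (@mfps_coef_mul (mdivisors m)) //.
have ms : m \in mdivisors m by apply/mem_mdivisors.
have os : mone \in mdivisors m by apply/mem_mdivisors => i; rewrite cm1.
rewrite (bigD1_seq mone) ?fset_uniq //= [X in _ + X]big1_seq ?addr0; last first.
  move=> a /andP[/negbTE aN1 _]; rewrite big1 // => b _.
  by rewrite aN1 mul0r if_same.
rewrite (bigD1_seq m) ?fset_uniq //= mul1m eqxx big1 ?addr0 ?eqxx ?mul1r //.
by move=> b /negbTE bNm; rewrite mul1m bNm.
Qed.

Fact mfps_mulDl : left_distributive mfps_mul mfps_add.
Proof.
move=> f g h; apply/mfpsP => m.
have coefD u v n : mfps_coef (mfps_add u v) n = mfps_coef u n + mfps_coef v n.
  by [].
rewrite coefD !(@mfps_coef_mul (mdivisors m)) //.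
rewrite -big_split; apply: eq_bigr => a _; rewrite -big_split.
by apply: eq_bigr => b _ /=; case: ifP; rewrite ?addr0 // mulrDl.
Qed.

Fact mfps_one_neq0 : mfps_one != 0.
Proof.
apply/eqP => /(congr1 (fun f => mfps_coef f mone)) /eqP.
by rewrite /= eqxx oner_eq0.
Qed.

HB.instance Definition _ := GRing.Zmodule_isComNzRing.Build mfps
  mfps_mulA mfps_mulC mfps_mul1 mfps_mulDl mfps_one_neq0.

Fact mfps_scaleA c d f :
  mfps_scale c (mfps_scale d f) = mfps_scale (c * d) f.
Proof. by apply/mfpsP => m /=; rewrite mulrA. Qed.
Fact mfps_scale1 : left_id 1 mfps_scale.
Proof. by move=> f; apply/mfpsP => m /=; rewrite mul1r. Qed.
Fact mfps_scaleDr : right_distributive mfps_scale +%R.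
Proof. by move=> c f g; apply/mfpsP => m /=; rewrite mulrDr. Qed.
Fact mfps_scaleDl f : {morph mfps_scale^~ f : c d / c + d}.
Proof. by move=> c d; apply/mfpsP => m /=; rewrite mulrDl. Qed.

HB.instance Definition _ := GRing.Zmodule_isLmodule.Build R mfps
  mfps_scaleA mfps_scale1 mfps_scaleDr mfps_scaleDl.

Fact mfps_scaleAl c f g : c *: (f * g) = c *: f * g.
Proof.
apply/mfpsP => m.
transitivity (c * mfps_coef (mfps_mul f g) m) => //.
rewrite -[c *: f * g]/(mfps_mul (c *: f) g) !(@mfps_coef_mul (mdivisors m)) //.
rewrite big_distrr; apply: eq_bigr => a _; rewrite big_distrr.
by apply: eq_bigr => b _ /=; case: ifP; rewrite ?mulr0 // mulrA.
Qed.

HB.instance Definition _ := GRing.Lmodule_isLalgebra.Build R mfps mfps_scaleAl.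

Lemma mfps_coef0 m : mfps_coef (0 : mfps) m = 0. Proof. by []. Qed.
Lemma mfps_coef1 m : mfps_coef (1 : mfps) m = (m == mone)%:R.
Proof. by []. Qed.
Lemma mfps_coefN f m : mfps_coef (- f) m = - mfps_coef f m. Proof. by []. Qed.
Lemma mfps_coefD f g m : mfps_coef (f + g) m = mfps_coef f m + mfps_coef g m.
Proof. by []. Qed.
Lemma mfps_coefZ c f m : mfps_coef (c *: f) m = c * mfps_coef f m.
Proof. by []. Qed.
Lemma mfps_coefM f g m : mfps_coef (f * g) m =
  \sum_(a <- mdivisors m) \sum_(b <- mdivisors m)
    (if mmul a b == m then mfps_coef f a * mfps_coef g b else 0).
Proof. by apply: mfps_coef_mul. Qed.

Definition mfps_var (i : I) : mfps := MFPS (fun m => (m == ucm i)%:R).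

Lemma mfps_coef_prod (s : seq I) m :
  mfps_coef (\prod_(i <- s) mfps_var i) m =
  (m == \big[mmul/mone]_(i <- s) ucm i)%:R.
Proof.
elim: s m => [|i s IH] m; first by rewrite !big_nil.
rewrite !big_cons mfps_coefM; set M := \big[mmul/mone]_(j <- s) ucm j.
rewrite (eq_bigr (fun a => \sum_(b <- mdivisors m)
   ([&& mmul a b == m, a == ucm i & b == M])%:R)); last first.
  move=> a _; apply: eq_bigr => b _; rewrite IH -/M /=.
  by case: (_ == m); case: (a == _); case: (b == _); rewrite ?mulr1 ?mulr0.
have [->|Nm] := eqVneq m (mmul (ucm i) M); last first.
  rewrite big1 // => a _; rewrite big1 // => b _.
  case: eqP => //= abm; case: eqP => //= aE; case: eqP => //= bE.
  by case/eqP: Nm; rewrite -abm aE bE.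
set s' := mdivisors _.
have us : ucm i \in s' by apply: mdivisors_mull.
have Ms : M \in s' by apply: (@mdivisors_mull _ (ucm i)); rewrite mulmC.
rewrite (bigD1_seq (ucm i)) ?fset_uniq //= [X in _ + X]big1; last first.
  move=> a /negbTE aN; rewrite big1 // => b _.
  by rewrite aN andbF.
rewrite addr0 (bigD1_seq M) ?fset_uniq //= big1; last first.
  by move=> b /negbTE bN; rewrite bN !andbF.
by rewrite !eqxx addr0.
Qed.

(* Sum of a possibly infinite family, taken coefficient by coefficient.  It   *)
(* is meaningful for summable families only: \sum_(i \in _) is 0 when the     *)
(* summand has infinite support.                                              *)
Definition summable (T : choiceType) (P : set T) (F : T -> mfps) : Prop :=
  forall m, finite_set [set u | P u /\ mfps_coef (F u) m != 0].
Definition mfps_sum (T : choiceType) (P : set T) (F : T -> mfps) : mfps :=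
  MFPS (fun m => \sum_(u \in P) mfps_coef (F u) m).

End MFPSRing.

Section Content.
Variable I : choiceType.

Definition content (s : seq I) : {cmonom I} := \big[mmul/mone]_(i <- s) ucm i.

Lemma contentE s i : content s i = count_mem i s.
Proof.
elim: s => [|j s IH]; first by rewrite /content big_nil cm1.
by rewrite /content big_cons cmM -/(content s) IH cmU.
Qed.

Lemma finite_content (m : {cmonom I}) : finite_set [set s | content s = m].
Proof.
have [[s0 s0m]|Nm] := pselect (exists s, content s = m); last first.
  by apply: (@sub_finite_set _ _ set0) => // s sm; case: Nm; exists s.
apply: (@sub_finite_set _ _ [set` permutations s0]); last exact: finite_seq.
move=> s /= sm; rewrite mem_permutations; apply/allP => i _ /=.
by rewrite -!contentE sm s0m.
Qed.

Lemma finite_content_fset (m : {cmonom I}) :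
  finite_set [set S : {fset I} | content S = m].
Proof.
apply: (@sub_finite_set _ _ [set` fpowerset (finsupp m)]) => [S /= Sm|].
  rewrite fpowersetE; apply/fsubsetP => i iS.
  by rewrite -cmE_neq0 -Sm contentE count_uniq_mem ?fset_uniq // iS.
exact: finite_fset.
Qed.

End Content.

(* The letters of words, i.e. the indices of the variables x_1, x_2, ...      *)
Definition posint : choiceType := {k : nat | (0 < k)%N}.
Definition posint1 : posint := exist _ 1%N isT.

(* Here 'X : {poly int} is the variable t; the variable z is fpsX in          *)
(* {fps series}.                                                              *)
Notation series := (mfps posint {poly int}).

Definition xw (w : seq posint) : series := \prod_(k <- w) mfps_var _ k.

(* The letter w_(i+1); the default posint1 is irrelevant when i < size w.     *)
Definition letter (w : seq posint) (i : nat) : nat := val (nth posint1 w i).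

Definition smirnov (n : nat) : set (seq posint) :=
  [set w | size w = n /\
           forall i, (i < n.-1)%N -> letter w i <> letter w i.+1].

Definition des (w : seq posint) : nat :=
  #|[pred i : 'I_(size w).-1 | (letter w i > letter w i.+1)%N]|.

Definition Wlt (n : nat) : series :=
  mfps_sum [set w | smirnov n w /\ (letter w 0 < letter w n.-1)%N]
           (fun w => 'X^(des w) *: xw w).
Definition Wgt (n : nat) : series :=
  mfps_sum [set w | smirnov n w /\ (letter w 0 > letter w n.-1)%N]
           (fun w => 'X^(des w) *: xw w).
Definition Weq (n : nat) : series :=
  mfps_sum [set w | smirnov n w /\ letter w 0 = letter w n.-1]
           (fun w => 'X^(des w) *: xw w).

Definition elemsym (i : nat) : series :=
  mfps_sum [set S : {fset posint} | #|` S| = i]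
           (fun S => \prod_(k <- S) mfps_var _ k).

Lemma summable_words (P : set (seq posint)) :
  summable P (fun w => 'X^(des w) *: xw w : series).
Proof.
move=> m; apply: sub_finite_set (finite_content m) => w /= [_].
rewrite mfps_coef_prod.
have [<-//|_] := eqVneq m (content w).
by rewrite mulr0 eqxx.
Qed.

Lemma summable_elemsym (P : set {fset posint}) :
  summable P (fun S => \prod_(k <- S) mfps_var _ k : series).
Proof.
move=> m; apply: sub_finite_set (finite_content_fset m) => S /= [_].
rewrite mfps_coef_prod; have [<-//|_] := eqVneq m (content S).
by rewrite eqxx.
Qed.

Definition tbracket (m : nat) : {poly int} := \sum_(j < m) 'X^j.

Definition a_ (i : nat) : {poly int} := (tbracket i)^`().
Definition b_ (i : nat) : {poly int} :=
  \sum_(1 <= j < i) 'X^j *+ (i - j).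
Definition c_ (i : nat) : {poly int} := i%:R * 'X * tbracket (i - 2).

Lemma a_E i : a_ i = \sum_(j < i.-1) 'X^j *+ j.+1.
Proof.
rewrite /a_ /tbracket raddf_sum /=; case: i => [|i] /=; first by rewrite !big_ord0.
rewrite big_ord_recl derivXn mulr0n add0r.
by apply: eq_bigr => j _; rewrite derivXn.
Qed.

(* b_i(t) = t^(i-1) a_i(1/t), in the field of fractions of Z[t].              *)
Lemma b_E i : (0 < i)%N ->
  tofrac (b_ i) = tofrac 'X ^+ i.-1 *
    (map_poly (fun k : int => tofrac k%:P) (a_ i)).[(tofrac 'X)^-1].
Proof.
case: i => // i _ /=.
have X0 : tofrac ('X : {poly int}) != 0 by rewrite tofrac_eq0 polyX_eq0.
rewrite a_E /b_ big_add1 big_mkord /=.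
pose phi : {rmorphism int -> {fraction {poly int}}} := @tofrac _ \o polyC.
have phiX (u : {fraction {poly int}}) j k :
    (map_poly phi ('X^j *+ k)).[u] = u ^+ j *+ k.
  by rewrite rmorphMn /= map_polyXn hornerMn hornerXn.
rewrite -[map_poly _ _]/(map_poly phi _) !rmorph_sum horner_sum mulr_sumr.
rewrite [LHS](reindex_inj rev_ord_inj); apply: eq_bigr => j _.
have ji := ltn_ord j; rewrite phiX rmorphMn rmorphXn /=.
rewrite subnSK // subSn ?leq_subr // subKn 1?ltnW // mulrnAr exprVn.
by rewrite -expfB_cond ?(negbTE X0) // add0n ltnW.
Qed.

Definition Dser : {fps series} :=
  1 - fps_from 2 (fun i => ('X * tbracket i.-1) *: elemsym i).

Lemma Dser_unit : Dser \is a GRing.unit.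
Proof. by apply: fps_unit1; rewrite fps_coefD fps_coefN /= oppr0 addr0. Qed.

(* Main.v *)
(* Fix a finite alphabet and put y_a = x_a z.  Let F(a, b) be the generating
   function of the Smirnov words from a to b, and S_k the sum of F(a, b) over
   a < k, with total T.  Splitting off the first letter gives
     (1 + y_k) S_(k+1) = (1 + t y_k) S_k + y_k ([k = b] + T),
   a first-order recurrence in k.  Solving it up to the end determines T, and
   D * T and D * S_b come out as products over the alphabet.  Summing over b,
   D * (all words) and D * (words with w_1 < w_n) obey, as the alphabet grows by
   one letter y, recurrences Q' = (1 + y) Q + y prod (1 + t y_i) and
   L' = (1 + t y) L + y Q, which are those of sum [i]_t e_i z^i and
   sum a_i e_i z^i.  Splitting off the last letter instead exchanges the weights
   1 and t and gives the words with w_1 > w_n; the words with w_1 = w_n are the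
   remaining ones, and [i]_t - a_i - b_i = - c_i for i >= 2. *)
Require Import Defs.
From mathcomp Require Import all_boot all_order all_algebra ring zify.
From mathcomp Require Import finmap monalg.
From mathcomp Require Import boolp classical_sets functions cardinality fsbigop.

Import GRing.Theory.
Local Open Scope ring_scope.

(** * Linear recurrences *)

Definition prodw (R : comNzRingType) (y : nat -> R) (w : R) (m n : nat) : R :=
  \prod_(m <= i < n) (1 + w * y i).
Arguments prodw {R}.

(* The sum over i < k of y_i prod_(j < i) (1 + v y_j) prod_(i < j < k) (1 + u y_j):
   the division-free form of (prodw y u 0 k - prodw y v 0 k) / (u - v). *)
Fixpoint qsum (R : comNzRingType) (y : nat -> R) (u v : R) (k : nat) : R :=
  if k is k'.+1
  then (1 + u * y k') * qsum R y u v k' + y k' * prodw y v 0 k' else 0.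
Arguments qsum {R}.

Lemma prodwS (R : comNzRingType) (y : nat -> R) (w : R) (m n : nat) :
  (m <= n)%N -> prodw y w m n.+1 = prodw y w m n * (1 + w * y n).
Proof. by move=> mn; rewrite /prodw big_nat_recr. Qed.

Lemma prodw_nil (R : comNzRingType) (y : nat -> R) (w : R) (n : nat) :
  prodw y w n n = 1.
Proof. by rewrite /prodw big_geq. Qed.

Lemma prodwB (R : comNzRingType) (y : nat -> R) (u v : R) (k : nat) :
  prodw y u 0 k = prodw y v 0 k + (u - v) * qsum y u v k.
Proof.
elim: k => [|k IH]; first by rewrite !prodw_nil mulr0 addr0.
by rewrite !prodwS //= IH; ring.
Qed.

Lemma qsumC (R : comNzRingType) (y : nat -> R) (u v : R) (k : nat) :
  qsum y u v k = qsum y v u k.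
Proof.
elim: k => [//|k IH] /=; rewrite -IH (prodwB _ y u v); ring.
Qed.

Lemma lreg_prodw (R : comNzRingType) (y : nat -> R) (u : R) (m n : nat) :
  (forall k, GRing.lreg (1 + u * y k)) -> GRing.lreg (prodw y u m n).
Proof. by move=> regu; apply: big_ind => //; [apply: lreg1|apply: lregM]. Qed.

(** Reduces an identity modulo one hypothesis to [ring], given the cofactor [k]. *)
Lemma eq_of_multiple (R : comNzRingType) (k a b c d : R) :
  a = b -> c - d = k * (a - b) -> c = d.
Proof. by move=> ->; rewrite subrr mulr0 => /eqP; rewrite subr_eq0 => /eqP. Qed.
Arguments eq_of_multiple {R} k {a b c d}.

(* S k is the sum, over the letters a < k at one end of a word, of the generating
   function of the words with a at that end and b at the other end; u and v are
   the weights of stepping from k to a larger, resp. smaller, letter. *)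
Section PartialSums.
Variables (R : comNzRingType) (y : nat -> R) (u v : R) (N b : nat) (S : nat -> R).
Hypothesis ltbN : (b < N)%N.
Hypothesis S0 : S 0 = 0.
Hypothesis SS : forall k, (k < N)%N ->
  S k.+1 = S k + y k * ((k == b)%:R + u * (S N - S k.+1) + v * S k).
Hypothesis regu : forall k, GRing.lreg (1 + u * y k).
Let D := prodw y u 0 N - u * qsum y u v N.

Lemma partial_sum_rec k : (k < N)%N -> (1 + u * y k) * S k.+1 =
   (1 + v * y k) * S k + y k * ((k == b)%:R + u * S N).
Proof. by move=> kN; apply: (eq_of_multiple 1 (SS k kN)); ring. Qed.

(** The factor [prodw y u 0 k] clears denominators in the recurrence, whose only source below [b] is
    the total [S N]. *)
Lemma prodw_mul_S_le k : (k <= b)%N -> prodw y u 0 k * S k = u * S N * qsum y u v k.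
Proof.
elim: k => [|k IH] kb; first by rewrite S0 !mulr0.
rewrite prodwS // -mulrA partial_sum_rec 1?(ltn_trans kb) // (ltn_eqF kb) add0r.
apply: (eq_of_multiple (1 + v * y k) (IH (ltnW kb))).
rewrite /= (prodwB _ y u v); ring.
Qed.

(** Passing [b] adds the impulse [y b * prodw y u 0 b], which every later letter [j] multiplies by
    [1 + v * y j]. *)
Lemma prodw_mul_S_gt k : (b < k)%N -> (k <= N)%N ->
  prodw y u 0 k * S k =
    u * S N * qsum y u v k + y b * prodw y u 0 b * prodw y v b.+1 k.
Proof.
elim: k => [//|k IH]; rewrite ltnS leq_eqVlt => /orP[/eqP<- _|bk kN].
  rewrite prodwS // prodw_nil -mulrA partial_sum_rec // eqxx.
  apply: (eq_of_multiple (1 + v * y b) (prodw_mul_S_le _ (leqnn b))).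
  rewrite /= (prodwB _ y u v); ring.
rewrite !prodwS // -mulrA partial_sum_rec // (gtn_eqF bk) add0r.
apply: (eq_of_multiple (1 + v * y k) (IH bk (ltnW kN))).
rewrite /= (prodwB _ y u v k); ring.
Qed.

(** At [k = N] the total stands on both sides of [prodw_mul_S_gt]; collecting it produces [D]. *)
Lemma D_total : D * S N = y b * prodw y u 0 b * prodw y v b.+1 N.
Proof.
by apply: (eq_of_multiple 1 (prodw_mul_S_gt N ltbN (leqnn N))); rewrite /D; ring.
Qed.

(** After multiplication by the regular factor [prodw y u 0 b], [prodw_mul_S_le] and [D_total] give
    the claim. *)
Lemma D_part : D * S b = u * y b * qsum y u v b * prodw y v b.+1 N.
Proof.
apply: (lreg_prodw _ y u 0 b regu).
rewrite mulrCA (prodw_mul_S_le b (leqnn b)).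
apply: (eq_of_multiple (u * qsum y u v b) D_total); ring.
Qed.
End PartialSums.

Lemma sum_total (R : comNzRingType) (y : nat -> R) (u v : R) (N : nat) :
  \sum_(0 <= b < N) y b * prodw y u 0 b * prodw y v b.+1 N = qsum y u v N.
Proof.
elim: N => [|N IH]; first by rewrite big_geq.
(* By symmetry [qsum] also gains the factor [1 + v * y N], the one that the old summands acquire. *)
rewrite qsumC /= -qsumC -IH big_nat_recr //= prodw_nil mulr1 mulr_sumr.
congr (_ + _); apply: eq_big_nat => b /andP[_ bN].
by rewrite prodwS //; ring.
Qed.

(** The right-hand sides of [D_part] summed over [b], in recursive form. Weights [(1, t)] give the
    numerator for [w_1 < w_n], weights [(t, 1)] that for [w_1 > w_n]. *)
Fixpoint lsum (R : comNzRingType) (y : nat -> R) (u v : R) (k : nat) : R :=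
  if k is k'.+1
  then (1 + v * y k') * lsum R y u v k' + u * y k' * qsum y u v k' else 0.
Arguments lsum {R}.

Lemma sum_part (R : comNzRingType) (y : nat -> R) (u v : R) (N : nat) :
  \sum_(0 <= b < N) u * y b * qsum y u v b * prodw y v b.+1 N = lsum y u v N.
Proof.
elim: N => [|N IH]; first by rewrite big_geq.
rewrite /= -IH big_nat_recr //= prodw_nil mulr1 mulr_sumr.
congr (_ + _); apply: eq_big_nat => b /andP[_ bN].
by rewrite prodwS //; ring.
Qed.

(** * Words over a finite alphabet *)

Section FpsCoef.
Variable A : comNzRingType.
Implicit Types (c : A) (f : {fps A}).

Lemma fps_coef_sum (I : Type) (r : seq I) (P : pred I) (F : I -> {fps A}) n :
  fps_coef (\sum_(i <- r | P i) F i) n = \sum_(i <- r | P i) fps_coef (F i) n.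
Proof. by apply: (big_morph (fun f => fps_coef f n)). Qed.

Lemma fps_coefCM c f n : fps_coef (fpsC c * f) n = c * fps_coef f n.
Proof.
rewrite fps_coefM big_ord_recl subn0 big1 ?addr0 // => i _.
by rewrite mul0r.
Qed.

Lemma fps_coefCX c n : fps_coef (fpsC c * fpsX) n = if n == 1%N then c else 0.
Proof. by rewrite fps_coefCM /=; case: eqP; rewrite ?mulr1 ?mulr0. Qed.

Lemma fps_coefCXM c f n :
  fps_coef (fpsC c * fpsX * f) n = if n is n'.+1 then c * fps_coef f n' else 0.
Proof.
rewrite fps_coefM; case: n => [|n].
  by rewrite big_ord1 fps_coefCX mul0r.
rewrite 2!big_ord_recl !fps_coefCX mul0r add0r big1; last first.
  by move=> i _; rewrite fps_coefCX mul0r.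
by rewrite addr0 /= subSS subn0.
Qed.

Lemma fpsC1 : fpsC 1 = 1 :> {fps A}.
Proof. by apply/fpsP => -[|n]. Qed.

Lemma fpsC0 : fpsC 0 = 0 :> {fps A}.
Proof. by apply/fpsP => -[|n]. Qed.
End FpsCoef.

Fixpoint words (N n : nat) : seq (seq nat) :=
  if n is n'.+1 then [seq a :: w | a <- iota 0 N, w <- words N n'] else [:: [::]].

Lemma mem_words N n w :
  (w \in words N n) = (size w == n) && all (fun a => a < N)%N w.
Proof.
elim: n w => [|n IH] [|a w] //=; first by apply/negP => /allpairsP[[? ?] []].
rewrite eqSS; apply/allpairsP/and3P => [[[b v] /= [bN vn [-> ->]]]|[wn aN wN]].
  by move: vn bN; rewrite IH mem_iota add0n => /andP[-> ->] /= ->.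
by exists (a, w); split=> //=; rewrite ?mem_iota // IH wn.
Qed.

Lemma uniq_words N n : uniq (words N n).
Proof.
elim: n => //= n IH; rewrite allpairs_uniq ?iota_uniq //.
by move=> [a v] [b w] _ _ /= [-> ->].
Qed.

Section Walks.
Variables (A : comNzRingType) (x : nat -> A) (t : A) (N : nat).

(** Weight 0 at equality enforces the Smirnov condition. The ring varies because both [t] and the
    series [fpsC t] serve as [s]. *)
Definition step (B : comNzRingType) (s : B) (a c : nat) : B :=
  if (a < c)%N then 1 else if (c < a)%N then s else 0.
Arguments step {B}.

Fixpoint wpath (a : nat) (w : seq nat) : A :=
  if w is c :: w' then step t a c * x c * wpath c w' else 1.

Fixpoint descents (a : nat) (w : seq nat) : nat :=
  if w is c :: w' then ((c < a) + descents c w')%N else 0.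

Lemma wpathE a w : x a * wpath a w =
  if path (fun b c => b != c) a w
  then t ^+ descents a w * \prod_(c <- a :: w) x c else 0.
Proof.
elim: w a => [|c w IH] a; first by rewrite /= big_seq1 mulr1 mul1r.
rewrite big_cons /= -[step t a c * _ * _]mulrA IH /step.
by case: ltngtP => [ac|ca|->] /=; case: ifP => _; rewrite ?exprS; ring.
Qed.

(** Here [n] counts the letters after the first, so the words have length [n + 1]. *)
Definition wsum (n a b : nat) : A :=
  \sum_(w <- words N n | last a w == b) x a * wpath a w.

Lemma wsum0 a b : wsum 0 a b = x a * (a == b)%:R.
Proof.
by rewrite /wsum big_cons big_nil /=; case: eqP; rewrite ?mulr0 // !mulr1 addr0.
Qed.

Lemma wsumS n a b :
  wsum n.+1 a b = x a * \sum_(0 <= c < N) step t a c * wsum n c b.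
Proof.
rewrite /wsum /= big_mkcond big_allpairs_dep mulr_sumr /index_iota subn0.
apply: eq_bigr => c _; rewrite -big_mkcond 2!mulr_sumr.
by apply: eq_bigr => w _ /=; ring.
Qed.

(** As for powers of a matrix, the recursion at the last letter follows from [wsumS] by induction
    and an exchange of sums. *)
Lemma wsumSr n a b : (a < N)%N -> (b < N)%N ->
  wsum n.+1 a b = x b * \sum_(0 <= c < N) step t c b * wsum n a c.
Proof.
have pick (G : nat -> A) c : (c < N)%N ->
    \sum_(0 <= i < N) G i * (i == c)%:R = G c.
  move=> cN; rewrite (bigD1_seq c) ?mem_index_iota ?iota_uniq //= eqxx mulr1.
  by rewrite big1 ?addr0 // => i /negbTE->; rewrite mulr0.
elim: n a b => [|n IH] a b aN bN; rewrite wsumS.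
  under eq_bigr do rewrite wsum0 mulrA; rewrite pick //.
  under eq_bigr do rewrite wsum0 mulrA eq_sym; rewrite pick //; ring.
transitivity (\sum_(0 <= c < N) \sum_(0 <= d < N)
    x a * step t a c * (x b * step t d b * wsum n c d)).
  rewrite mulr_sumr; apply: eq_big_nat => c /andP[_ cN].
  by rewrite IH // !mulr_sumr; apply: eq_bigr => d _; ring.
rewrite exchange_big_nat mulr_sumr; apply: eq_bigr => d _.
by rewrite wsumS !mulr_sumr; apply: eq_bigr => c _; ring.
Qed.

Definition wser (a b : nat) : {fps A} :=
  FPS (fun n => if n is n'.+1 then wsum n' a b else 0).

Let y (a : nat) : {fps A} := fpsC (x a) * fpsX.
Let s : {fps A} := fpsC t.

Lemma fpsC_step a c : fpsC (step t a c) = step s a c.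
Proof. by rewrite /step; do 2?case: ifP => _; rewrite ?fpsC1 ?fpsC0. Qed.

Lemma wserE a b :
  wser a b = y a * ((a == b)%:R + \sum_(0 <= c < N) step s a c * wser c b).
Proof.
apply/fpsP => -[|n]; rewrite fps_coefCXM // fps_coefD fps_coef_sum.
under eq_bigr do rewrite -fpsC_step fps_coefCM.
case: n => [|n] /=; last first.
  by rewrite wsumS; case: eqP; rewrite add0r.
by rewrite wsum0 big1 ?addr0; [case: eqP | move=> c _; rewrite mulr0].
Qed.

Lemma wserEr a b : (a < N)%N -> (b < N)%N ->
  wser a b = y b * ((b == a)%:R + \sum_(0 <= c < N) step s c b * wser a c).
Proof.
move=> aN bN.
apply/fpsP => -[|n]; rewrite fps_coefCXM // fps_coefD fps_coef_sum.
under eq_bigr do rewrite -fpsC_step fps_coefCM.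
case: n => [|n] /=; last first.
  by rewrite wsumSr //; case: eqP; rewrite add0r.
rewrite wsum0 big1 ?addr0; last by move=> c _; rewrite mulr0.
by rewrite eq_sym; case: eqP => [->|_]; rewrite ?mulr0.
Qed.

(** The equal letter has weight 0, which leaves a tail above [k] and a head below it. Both [u] and
    [v] stay free because the two ends of a word exchange them. *)
Lemma sum_cut (B : comNzRingType) (u v : B) (G : nat -> B) k : (k < N)%N ->
  \sum_(0 <= c < N) (if (k < c)%N then u else if (c < k)%N then v else 0) * G c =
  u * (\sum_(0 <= c < N) G c - \sum_(0 <= c < k.+1) G c)
    + v * \sum_(0 <= c < k) G c.
Proof.
move=> kN; rewrite !(@big_cat_nat _ _ _ k.+1 0 N) //= addrAC subrr add0r addrC.
rewrite !mulr_sumr; congr (_ + _).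
  by apply: eq_big_nat => c /andP[->].
rewrite big_nat_recr //= ltnn mul0r addr0; apply: eq_big_nat => c /andP[_ ck].
by rewrite ck ltnNge ltnW.
Qed.

Lemma lreg_y (u : {fps A}) k : GRing.lreg (1 + u * y k).
Proof.
apply/mulrI/fps_unit1; rewrite fps_coefD fps_coef1 mulrC fps_coefCXM.
by rewrite addr0.
Qed.

(** A division-free form of [(prodw y s 0 N - s * prodw y 1 0 N) / (1 - s)]. *)
Definition Dfin : {fps A} := prodw y 1 0 N - qsum y 1 s N.

(* Prepending a letter k before a larger one costs 1 and before a smaller one t,
   so (u, v) = (1, t) here; in D_first k is appended, and (u, v) = (t, 1). *)
Lemma D_last b : (b < N)%N ->
  Dfin * \sum_(0 <= a < N) wser a b = y b * prodw y 1 0 b * prodw y s b.+1 N /\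
  Dfin * \sum_(0 <= a < b) wser a b
    = 1 * y b * qsum y 1 s b * prodw y s b.+1 N.
Proof.
move=> bN; pose S k := \sum_(0 <= a < k) wser a b.
have SS k : (k < N)%N ->
    S k.+1 = S k + y k * ((k == b)%:R + 1 * (S N - S k.+1) + s * S k).
  move=> kN; rewrite -addrA -sum_cut // {1}/S big_nat_recr //=.
  by rewrite [in LHS]wserE.
have -> : Dfin = prodw y 1 0 N - 1 * qsum y 1 s N by rewrite mul1r.
have S0 : S 0 = 0 by rewrite /S big_geq.
split; first exact: (D_total _ y 1 s N b S).
by apply: (D_part _ y 1 s N b S) => // k; apply: lreg_y.
Qed.

Lemma D_first a : (a < N)%N ->
  Dfin * \sum_(0 <= b < a) wser a b
    = s * y a * qsum y s 1 a * prodw y 1 a.+1 N.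
Proof.
move=> aN; pose S k := \sum_(0 <= b < k) wser a b.
have SS k : (k < N)%N ->
    S k.+1 = S k + y k * ((k == a)%:R + s * (S N - S k.+1) + 1 * S k).
  move=> kN; rewrite -addrA -sum_cut // {1}/S big_nat_recr //=.
  rewrite [in LHS]wserEr //; congr (_ + _ * (_ + _)).
  by apply: eq_bigr => c _; rewrite /step; case: ltngtP.
(* The denominator is unchanged when the weights [1] and [s] are exchanged. *)
have -> : Dfin = prodw y s 0 N - s * qsum y s 1 N.
  by rewrite /Dfin (prodwB _ y s 1) (qsumC _ y 1 s); ring.
have S0 : S 0 = 0 by rewrite /S big_geq.
by apply: (D_part _ y s 1 N a S) => // k; apply: lreg_y.
Qed.

Definition wrel (r : rel nat) : {fps A} :=
  \sum_(0 <= a < N) \sum_(0 <= b < N | r a b) wser a b.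

Lemma D_all : Dfin * wrel (fun _ _ => true) = qsum y 1 s N.
Proof.
rewrite /wrel exchange_big_nat -sum_total mulr_sumr.
by apply: eq_big_nat => b /andP[_ bN]; rewrite (D_last b bN).1.
Qed.

Lemma D_lt : Dfin * wrel ltn = lsum y 1 s N.
Proof.
rewrite /wrel (exchange_big_dep_nat predT) //= -sum_part mulr_sumr.
apply: eq_big_nat => b /andP[_ bN]; rewrite -(D_last b bN).2.
by rewrite [in RHS](big_nat_widen _ _ N) 1?ltnW.
Qed.

Lemma D_gt : Dfin * wrel (fun a b => b < a)%N = lsum y s 1 N.
Proof.
rewrite -sum_part mulr_sumr.
apply: eq_big_nat => a /andP[_ aN]; rewrite -D_first //.
by rewrite [in RHS](big_nat_widen _ _ N) 1?ltnW.
Qed.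

Lemma wrel_trichotomy : wrel (fun _ _ => true) =
  wrel ltn + wrel (fun a b => b < a)%N + wrel eq_op.
Proof.
rewrite /wrel -!big_split; apply: eq_bigr => a _.
rewrite [X in _ = X + _ + _]big_mkcond [X in _ = _ + X + _]big_mkcond.
rewrite [X in _ = _ + _ + X]big_mkcond -!big_split.
by apply: eq_bigr => b _ /=; case: ltngtP => _; rewrite ?addr0 ?add0r.
Qed.

Lemma D_eq : Dfin * wrel eq_op = qsum y 1 s N - lsum y 1 s N - lsum y s 1 N.
Proof. by rewrite -D_all -D_lt -D_gt wrel_trichotomy; ring. Qed.
End Walks.

Arguments step {B}.
Arguments wpath {A}.
Arguments wser {A}.
Arguments wrel {A}.
Arguments Dfin {A}.

(** * Elementary symmetric functions of a finite alphabet *)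

Section ElementarySymmetric.
Variables (A : comNzRingType) (x : nat -> A).
Let y (a : nat) : {fps A} := fpsC (x a) * fpsX.

Fixpoint elemf (N i : nat) : A :=
  match N, i with
  | _, 0 => 1
  | 0, _.+1 => 0
  | N'.+1, i'.+1 => elemf N' i'.+1 + x N' * elemf N' i'
  end.

Definition eser (N : nat) (c : nat -> A) : {fps A} :=
  FPS (fun i => c i * elemf N i).

Lemma eser0 c : eser 0 c = fpsC (c 0).
Proof. by apply/fpsP => -[|i] /=; rewrite ?mulr1 ?mulr0. Qed.

(** A new letter contributes through the shifted coefficient sequence. This turns recurrences in the
    alphabet size into recurrences in the degree. *)
Lemma eserS N c : eser N.+1 c = eser N c + y N * eser N (c \o succn).
Proof.
apply/fpsP => -[|i]; rewrite fps_coefD fps_coefCXM /=.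
  by rewrite addr0; case: N.
by ring.
Qed.

Lemma eserD N c d : eser N (fun i => c i + d i) = eser N c + eser N d.
Proof. by apply/fpsP => i; rewrite fps_coefD /= mulrDl. Qed.

Lemma eserB N c d : eser N (fun i => c i - d i) = eser N c - eser N d.
Proof. by apply/fpsP => i; rewrite fps_coefD fps_coefN /= mulrBl. Qed.

Lemma eserZ N u c : eser N (fun i => u * c i) = fpsC u * eser N c.
Proof. by apply/fpsP => i; rewrite fps_coefCM /= mulrA. Qed.

Lemma eq_eser N c d : c =1 d -> eser N c = eser N d.
Proof. by move=> cd; apply/fpsP => i /=; rewrite cd. Qed.

Lemma prodw_eser N v : prodw y (fpsC v) 0 N = eser N (fun i => v ^+ i).
Proof.
elim: N => [|N IH]; first by rewrite prodw_nil eser0 fpsC1.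
rewrite prodwS // IH eserS.
under [X in y N * X]eq_eser do rewrite /= exprS.
by rewrite eserZ; ring.
Qed.

Variables (u v : A) (q : nat -> A).
Hypothesis q0 : q 0 = 0.
Hypothesis qS : forall i, q i.+1 = u * q i + v ^+ i.

(** The hypotheses make [q i] the division-free form of [(u^i - v^i) / (u - v)]. *)
Lemma qsum_eser N : qsum y (fpsC u) (fpsC v) N = eser N q.
Proof.
elim: N => [|N IH] /=; first by rewrite eser0 q0 fpsC0.
rewrite IH eserS prodw_eser.
under [X in _ = _ + _ * X]eq_eser do rewrite /= qS.
by rewrite eserD eserZ; ring.
Qed.

Variable l : nat -> A.
Hypothesis l0 : l 0 = 0.
Hypothesis lS : forall i, l i.+1 = v * l i + u * q i.

Lemma lsum_eser N : lsum y (fpsC u) (fpsC v) N = eser N l.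
Proof.
elim: N => [|N IH] /=; first by rewrite eser0 l0 fpsC0.
rewrite IH eserS qsum_eser.
under [X in _ = _ + _ * X]eq_eser do rewrite /= lS.
by rewrite eserD !eserZ; ring.
Qed.
End ElementarySymmetric.

Arguments elemf {A}.
Arguments eser {A}.

(** * Reduction to a finite alphabet *)

(* Agreement on the monomials in x_1, ..., x_N is a congruence, which reduces the
   theorem to a finite alphabet. *)
Definition supp_le (N : nat) (m : {cmonom posint}) : Prop :=
  forall k : posint, (N < val k)%N -> m k = 0%N.

Definition eq_upto (N : nat) (f g : series) : Prop :=
  forall m, supp_le N m -> mfps_coef f m = mfps_coef g m.

Lemma eq_upto_all (f g : series) : (forall N, eq_upto N f g) -> f = g.
Proof.
move=> fg; apply: mfpsP => m.
(* [N] is the largest index of a variable occurring in [m]. *)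
apply: (fg (\max_(k <- finsupp m) val k)) => k mk.
apply/eqP; apply: contraTT mk; rewrite cmE_neq0 -leqNgt => km.
by rewrite (big_fsetD1 k) //= leq_maxl.
Qed.

Lemma mfps_coef_bigsum (I : Type) (r : seq I) (P : pred I) (F : I -> series) m :
  mfps_coef (\sum_(i <- r | P i) F i) m = \sum_(i <- r | P i) mfps_coef (F i) m.
Proof. by apply: (big_morph (fun f : series => mfps_coef f m)). Qed.

Lemma eq_upto_sum N (I : Type) (r : seq I) (P : pred I) (F G : I -> series) :
  (forall i, eq_upto N (F i) (G i)) ->
  eq_upto N (\sum_(i <- r | P i) F i) (\sum_(i <- r | P i) G i).
Proof.
by move=> FG m Nm; rewrite !mfps_coef_bigsum; apply: eq_bigr => i _; apply: FG.
Qed.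

(** Divisors of a monomial in [x_1, ..., x_N] are again such monomials. *)
Lemma eq_uptoM N (f g f' g' : series) :
  eq_upto N f f' -> eq_upto N g g' -> eq_upto N (f * g) (f' * g').
Proof.
move=> ff gg m Nm; rewrite !mfps_coefM !big_seq.
apply: eq_bigr => a /mem_mdivisors am; rewrite !big_seq.
apply: eq_bigr => b /mem_mdivisors bm; case: ifP => // _.
by congr (_ * _); [apply: ff | apply: gg] => k /Nm mk;
  [have := am k | have := bm k]; rewrite mk leqn0 => /eqP.
Qed.

Definition fps_eq_upto (N : nat) (f g : {fps series}) : Prop :=
  forall n, eq_upto N (fps_coef f n) (fps_coef g n).

Lemma fps_eq_uptoM N (f g f' g' : {fps series}) :
  fps_eq_upto N f f' -> fps_eq_upto N g g' -> fps_eq_upto N (f * g) (f' * g').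
Proof.
by move=> ff gg n; rewrite !fps_coefM; apply: eq_upto_sum => i; apply: eq_uptoM.
Qed.

Lemma eq_upto_mfps_sum N (T : choiceType) (P : set T) (F : T -> series)
    (r : seq T) :
  uniq r -> (forall u, u \in r -> P u) ->
  (forall u, P u -> u \notin r -> eq_upto N (F u) 0) ->
  eq_upto N (mfps_sum P F) (\sum_(u <- r) F u).
Proof.
move=> ur rP Pr m Nm; rewrite mfps_coef_bigsum /=.
rewrite (@fsbigE _ _ _ _ _ r) //; last by move=> u Pu /(Pr u Pu)/(_ m Nm).
by rewrite big_seq_cond [RHS]big_seq; apply: eq_bigl => u;
   case: (boolP (u \in r)) => //= /rP Pu; apply: mem_set.
Qed.

Definition pos (a : nat) : posint := exist _ a.+1 isT.

Lemma pos_inj : injective pos.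
Proof. by move=> a b [] . Qed.

Lemma posK (k : posint) : pos (val k).-1 = k.
Proof. by apply: val_inj => /=; case: k => -[]. Qed.

Lemma letter_map w i : (i < size w)%N -> letter (map pos w) i = (nth 0 w i).+1.
Proof. by move=> iw; rewrite /letter (nth_map 0%N). Qed.

Definition xvar (a : nat) : series := mfps_var _ (pos a).
Definition tvar : series := 'X%:A.

Lemma mfps_coef_xw w m : mfps_coef (xw w) m = (m == content w)%:R.
Proof. exact: mfps_coef_prod. Qed.

Lemma des_cons2 a c w :
  des [:: pos a, pos c & map pos w] = ((c < a) + des (pos c :: map pos w))%N.
Proof.
rewrite /des -!sum1_card /= big_mkcond [in RHS]big_mkcond big_ord_recl /=.
by congr addn; rewrite unfold_in /letter /= ltnS; case: ifP.
Qed.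

Lemma des1 k : des [:: k] = 0%N.
Proof. by apply: eq_card0 => -[]. Qed.

Lemma des_map_pos a w : des (map pos (a :: w)) = descents a w.
Proof.
by elim: w a => [|c w IH] a; rewrite ?des1 // [map _ _]/= des_cons2 /= -IH.
Qed.

Lemma tvarM k f : tvar ^+ k * f = 'X^k *: f.
Proof.
rewrite -mulr_algl; congr (_ * _).
exact/esym/(rmorphXn (GRing.in_alg series)).
Qed.

Lemma xw_map_pos w : xw (map pos w) = \prod_(a <- w) xvar a.
Proof. by rewrite /xw big_map. Qed.

Local Notation xwrel N := (wrel xvar tvar N).

Lemma mem_words_of_content N m (w : seq posint) :
  supp_le N m -> m = content w ->
  map (fun k => (val k).-1) w \in words N (size w).
Proof.
move=> Nm mw; rewrite mem_words size_map eqxx all_map /=.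
apply/allP => k kw /=; have k0 := valP k.
rewrite -ltnS prednK //= ltnS leqNgt; apply/negP => /Nm.
by rewrite mw contentE => /eqP; rewrite -leqn0 leqNgt -has_count has_pred1 kw.
Qed.

Lemma smirnov_map_pos n w : size w = n.+1 ->
  smirnov n.+1 (map pos w) <-> sorted (fun b c => b != c) w.
Proof.
move=> wn; split=> [[_ sw]|/(sortedP 0%N) sw].
  apply/(sortedP 0%N) => i; rewrite wn ltnS => iw.
  have := sw i iw; rewrite !letter_map ?wn ?ltnS ?(ltnW iw) // => ne.
  by apply/eqP => e; apply: ne; rewrite e.
split=> [|i iw]; first by rewrite size_map.
have iw' : (i.+1 < size w)%N by rewrite wn ltnS.
rewrite !letter_map ?(ltnW iw') // => -[e].
by have := sw i iw'; rewrite e eqxx.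
Qed.

(** [R] compares positive letters and [r] their 0-based versions, so that one lemma serves all three
    relations between the end letters. *)
Lemma words_eq_upto N (R : nat -> nat -> Prop) (r : rel nat) n :
  (forall a b, R a.+1 b.+1 <-> r a b) ->
  eq_upto N
    (mfps_sum [set w | smirnov n.+1 w /\ R (letter w 0) (letter w n)]
              (fun w => 'X^(des w) *: xw w))
    (fps_coef (xwrel N r) n.+1).
Proof.
move=> Rr; pose srt := sorted (fun b c : nat => b != c).
pose p w := srt w && r (head 0%N w) (last 0%N w).
have -> : fps_coef (xwrel N r) n.+1 =
    \sum_(w <- [seq map pos w | w <- words N n.+1 & p w]) 'X^(des w) *: xw w.
  rewrite big_map big_filter big_mkcond big_allpairs_dep fps_coef_sum.
  rewrite (_ : iota 0 N = index_iota 0 N); last by rewrite /index_iota subn0.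
  apply: eq_big_nat => a /andP[_ aN].
  rewrite fps_coef_sum [LHS]/= /wsum (exchange_big_dep predT) //=.
  rewrite !big_seq; apply: eq_bigr => w; rewrite mem_words => /andP[_ wN].
  under eq_bigl do rewrite [last a w == _]eq_sym.
  have lN : (last a w < N)%N.
    by have /allP := wN; have := mem_last a w; rewrite inE;
      case/predU1P => [-> //|lw]; apply.
  (* Only [b = last a w] contributes to the sum over last letters. *)
  rewrite (big_nat1_cond_eq _ (fun=> xvar a * wpath xvar tvar a w)) lN /=.
  rewrite wpathE tvarM -des_map_pos -xw_map_pos /p /=.
  by rewrite andbC; case: (r _ _).
apply: eq_upto_mfps_sum.
- rewrite map_inj_uniq ?filter_uniq ?uniq_words //.
  by apply: inj_map; apply: pos_inj.
- move=> _ /mapP[w + ->]; rewrite mem_filter mem_words.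
  case/andP=> /andP[sw rw] /andP[/eqP wn _] /=; split.
    by apply/smirnov_map_pos.
  rewrite !letter_map ?wn //; apply/Rr.
  by rewrite nth0 -[n]/(n.+1.-1) -wn nth_last.
(* A word contributing to a monomial in [x_1, ..., x_N] has all its letters at most [N], hence is
   already listed. *)
- move=> u [su Ru] uN m Nm; rewrite mfps_coefZ mfps_coef_xw.
  case: eqP => [mu|_]; last by rewrite mulr0.
  case/negP: uN; have un := su.1; set w := map (fun k => (val k).-1) u.
  have uw : map pos w = u.
    by rewrite /w -map_comp; apply: map_id_in => k _; apply: posK.
  apply/mapP; exists w => //; rewrite mem_filter -un (mem_words_of_content _ _ _ Nm mu).
  have wn : size w = n.+1 by rewrite size_map.
  rewrite andbT /p /srt; apply/andP; split.
    by apply/(smirnov_map_pos n w wn); rewrite uw.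
  by move: Ru; rewrite -uw !letter_map ?wn // nth0 -[n]/(n.+1.-1) -wn nth_last
    => /Rr.
Qed.

(** * Subsets of a finite alphabet *)

Fixpoint subs (N i : nat) : seq {fset posint} :=
  match N, i with
  | _, 0 => [:: fset0]
  | 0, _.+1 => [::]
  | N'.+1, i'.+1 => subs N' i'.+1 ++ [seq (pos N' |` B)%fset | B <- subs N' i']
  end.

Lemma mem_subs N i (S : {fset posint}) :
  reflect (#|` S| = i /\ forall k, k \in S -> (val k <= N)%N) (S \in subs N i).
Proof.
elim: N i S => [|N IH] [|i] S; rewrite [subs _ _]/= ?mem_seq1 ?in_nil.
- apply: (iffP eqP) => [->|[/cardfs0_eq->]] //; split=> [|k]; by rewrite ?cardfs0 ?inE.
- constructor=> -[Si SN]; have /fset0Pn[k /SN] : S != fset0.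
    by rewrite -cardfs_gt0 Si.
  by rewrite leqNgt (valP k).
- apply: (iffP eqP) => [->|[/cardfs0_eq->]] //; split=> [|k]; by rewrite ?cardfs0 ?inE.
rewrite mem_cat; apply: (iffP orP) => [[/IH[Si SN]|/mapP[T /IH[Ti TN] ->]]|[Si SN]].
- by split=> // k /SN/leqW.
- split=> [|k]; last by rewrite !inE => /predU1P[->//|/TN/leqW].
  rewrite cardfsU1 Ti; case: (boolP (_ \in _)) => // /TN.
  by rewrite /= ltnn.
have lek k : k \in S -> k != pos N -> (val k <= N)%N.
  move=> /SN; rewrite leq_eqVlt => /predU1P[kN /eqP[]|//].
  exact: val_inj.
case: (boolP (pos N \in S)) => NS; [right|left].
  apply/mapP; exists (S `\ pos N)%fset; last by rewrite fsetD1K.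
  apply/IH; split=> [|k].
    by move: Si; rewrite (cardfsD1 (pos N)) NS => -[].
  by rewrite !inE => /andP[kN /lek->].
apply/IH; split=> // k kS; apply: lek => //.
by apply: contraNneq NS => <-.
Qed.

Lemma pos_notin_subs N i (S : {fset posint}) : S \in subs N i -> pos N \notin S.
Proof. by move=> /mem_subs[_ SN]; apply/negP => /SN; rewrite /= ltnn. Qed.

Lemma uniq_subs N i : uniq (subs N i).
Proof.
elim: N i => [|N IH] [|i] //=; rewrite cat_uniq IH /=; apply/andP; split.
  apply/hasPn => _ /mapP[S _ ->]; apply/negP => /pos_notin_subs.
  by rewrite !inE eqxx.
rewrite map_inj_in_uniq // => S T /pos_notin_subs NS /pos_notin_subs NT.
by move/(congr1 (fun U => U `\ pos N)%fset); rewrite !fsetU1K.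
Qed.

(** [subs] splits the sets by whether they contain the largest letter, in step with the recursion of
    [elemf]. *)
Lemma elemf_subs N i :
  elemf xvar N i = \sum_(B <- subs N i) \prod_(k <- B) mfps_var _ k.
Proof.
elim: N i => [|N IH] [|i] /=; rewrite ?big_seq1 ?big_nil ?big_seq_fset0 //.
rewrite big_cat big_map /= -IH; congr (_ + _).
rewrite IH mulr_sumr !big_seq; apply: eq_bigr => S /pos_notin_subs NS.
by rewrite big_fsetU1.
Qed.

Lemma elemsym_eq_upto N i : eq_upto N (elemsym i) (elemf xvar N i).
Proof.
rewrite elemf_subs; apply: eq_upto_mfps_sum; first exact: uniq_subs.
  by move=> S /mem_subs[].
move=> S Si SN m Nm; rewrite mfps_coef_prod.
case: eqP => // mS; case/negP: SN; apply/mem_subs; split=> // k kS.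
rewrite leqNgt; apply/negP => /Nm; rewrite mS contentE => /eqP.
by rewrite -leqn0 leqNgt -has_count has_pred1 kS.
Qed.

(** * Coefficients *)

Lemma tbracketS i : tbracket i.+1 = tbracket i + 'X^i.
Proof. by rewrite /tbracket big_ord_recr. Qed.

Lemma tbracketSl i : tbracket i.+1 = 'X * tbracket i + 1.
Proof.
rewrite /tbracket big_ord_recl addrC mulr_sumr; congr (_ + _).
by apply: eq_bigr => j _; rewrite exprS.
Qed.

(** This is the derivative of [tbracketSl]. *)
Lemma a_S i : a_ i.+1 = 'X * a_ i + tbracket i.
Proof. by rewrite /a_ tbracketSl derivD derivM derivX derivC; ring. Qed.

Lemma b_S i : b_ i.+1 = b_ i + 'X * tbracket i.
Proof.
(* The added term at [j = i] is zero and makes the ranges agree. *)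
have -> : b_ i = \sum_(1 <= j < i.+1) 'X^j *+ (i - j).
  case: i => [|i]; first by rewrite /b_ !big_geq.
  by rewrite [RHS]big_nat_recr //= subnn mulr0n addr0.
rewrite /tbracket mulr_sumr -(big_mkord predT (fun j => 'X * 'X^j)).
rewrite [X in _ + X](_ : _ = \sum_(1 <= j < i.+1) 'X^j); last first.
  by rewrite big_add1; apply: eq_bigr => j _; rewrite exprS.
rewrite -big_split; apply: eq_big_nat => j /andP[_ ji] /=.
by rewrite subSn // mulrSr.
Qed.

(** The exponents 0 and [i - 1] cancel, and at [1 <= j <= i - 2] the coefficient is
    [(j + 1) + (i - j) - 1 = i]. At [i = 1] the right-hand side would be [-1], whence the separate
    term [e_1 z] of the theorem. *)
Lemma c_E i : (1 < i)%N -> c_ i = a_ i + b_ i - tbracket i.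
Proof.
case: i => [|[|k]] // _; rewrite a_E /b_ big_add1 /= big_mkord /tbracket.
rewrite [X in X + _ - _]big_ord_recl [X in _ + X - _]big_ord_recr.
rewrite [X in _ - X]big_ord_recl [X in _ - (_ + X)]big_ord_recr /=.
rewrite subSnn /c_ subn2 /= /tbracket mulr_sumr.
rewrite !mulr1n.
set s1 := \sum_(_ < _) _ *+ _; set s2 := \sum_(_ < _) _ *+ _.
set s4 := \sum_(_ < _) 'X^(bump _ _).
have -> : \sum_(j < k) k.+2%:R * 'X * 'X^j = s1 + s2 - s4.
  rewrite -big_split -sumrB; apply: eq_bigr => j _ /=.
  rewrite -mulrA -exprS mulr_natl -mulrnDr.
  rewrite (_ : (_ + _)%N = k.+3) ?mulrSr ?addrK //.
  by have := ltn_ord j; rewrite /bump; lia.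
rewrite /bump /= !add1n; ring.
Qed.

Definition talg (c : {poly int}) : series := c%:A.

Lemma talgD : {morph talg : c d / c + d}.
Proof. exact: (rmorphD (GRing.in_alg series)). Qed.
Lemma talgN : {morph talg : c / - c}.
Proof. exact: (rmorphN (GRing.in_alg series)). Qed.
Lemma talgM : {morph talg : c d / c * d}.
Proof. exact: (rmorphM (GRing.in_alg series)). Qed.
Lemma talgXn k : talg 'X^k = tvar ^+ k.
Proof. exact: (rmorphXn (GRing.in_alg series)). Qed.

Lemma talg_tbracketS i : talg (tbracket i.+1) = 1 * talg (tbracket i) + tvar ^+ i.
Proof. by rewrite tbracketS talgD talgXn mul1r. Qed.

(** In the form [q i.+1 = u * q i + v ^+ i], the weights [(1, t)] call for [talg_tbracketS] and
    [(t, 1)] for this recurrence. *)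
Lemma talg_tbracketSl i :
  talg (tbracket i.+1) = tvar * talg (tbracket i) + 1 ^+ i.
Proof. by rewrite tbracketSl talgD talgM expr1n /talg scale1r. Qed.

Lemma talg_a_S i : talg (a_ i.+1) = tvar * talg (a_ i) + 1 * talg (tbracket i).
Proof. by rewrite a_S talgD talgM mul1r. Qed.

Lemma talg_b_S i : talg (b_ i.+1) = 1 * talg (b_ i) + tvar * talg (tbracket i).
Proof. by rewrite b_S talgD talgM mul1r. Qed.

Lemma tbracket0 : tbracket 0 = 0. Proof. by rewrite /tbracket big_ord0. Qed.
Lemma a_0 : a_ 0 = 0. Proof. by rewrite /a_ tbracket0 deriv0. Qed.
Lemma b_0 : b_ 0 = 0. Proof. by rewrite /b_ big_geq. Qed.
Lemma talg0 : talg 0 = 0. Proof. exact: scale0r. Qed.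

Local Notation xeser N c := (eser xvar N c).
Local Notation xDfin N := (Dfin xvar tvar N).

Lemma qsum_xvar N :
  qsum (fun a => fpsC (xvar a) * fpsX) 1 (fpsC tvar) N =
  xeser N (fun i => talg (tbracket i)).
Proof.
rewrite -fpsC1; apply: qsum_eser; last exact: talg_tbracketS.
by rewrite tbracket0 talg0.
Qed.

(** At weight 1 the product is the sum of all [e_i z^i]. The value [1 - [i]_t] is 1 at [i = 0], 0 at
    [i = 1] and [-t [i-1]_t] beyond, as in [Dser]. *)
Lemma Dfin_eser N : xDfin N = xeser N (fun i => 1 - talg (tbracket i)).
Proof.
rewrite /Dfin qsum_xvar -fpsC1 prodw_eser -eserB.
by apply: eq_eser => i; rewrite expr1n.
Qed.

Lemma lsum_a N :
  lsum (fun a => fpsC (xvar a) * fpsX) 1 (fpsC tvar) N =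
  xeser N (fun i => talg (a_ i)).
Proof.
rewrite -fpsC1; apply: lsum_eser talg_a_S N; rewrite ?tbracket0 ?a_0 ?talg0 //.
exact: talg_tbracketS.
Qed.

Lemma lsum_b N :
  lsum (fun a => fpsC (xvar a) * fpsX) (fpsC tvar) 1 N =
  xeser N (fun i => talg (b_ i)).
Proof.
rewrite -fpsC1; apply: lsum_eser talg_b_S N; rewrite ?tbracket0 ?b_0 ?talg0 //.
exact: talg_tbracketSl.
Qed.

Lemma wrel_lt N : xDfin N * xwrel N ltn = xeser N (fun i => talg (a_ i)).
Proof. by rewrite D_lt lsum_a. Qed.

Lemma wrel_gt N :
  xDfin N * xwrel N (fun a b => b < a)%N = xeser N (fun i => talg (b_ i)).
Proof. by rewrite D_gt lsum_b. Qed.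

Lemma wrel_eq N : xDfin N * xwrel N eq_op =
  xeser N (fun i => talg (tbracket i) - talg (a_ i) - talg (b_ i)).
Proof. by rewrite D_eq qsum_xvar lsum_a lsum_b !eserB. Qed.

(** * From finite alphabets to all positive integers *)

Lemma eq_uptoZ N c f g : eq_upto N f g -> eq_upto N (c *: f) (c *: g).
Proof. by move=> fg m Nm; rewrite !mfps_coefZ fg. Qed.

Lemma eq_uptoB N f f' g g' :
  eq_upto N f f' -> eq_upto N g g' -> eq_upto N (f - g) (f' - g').
Proof.
by move=> ff gg m Nm; rewrite !mfps_coefD !mfps_coefN ff // gg.
Qed.

Lemma elemf0 N : elemf xvar N 0 = 1. Proof. by case: N. Qed.

Lemma one_sub_tbracket i :
  1 - talg (tbracket i.+1) = - talg ('X * tbracket i).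
Proof.
by rewrite tbracketSl talgD {2}/talg scale1r opprD addrCA subrr addr0.
Qed.

Lemma talgN_scale c f : - talg c * f = - (c *: f).
Proof. by rewrite mulNr mulr_algl. Qed.

Lemma Dser_eq_upto N : fps_eq_upto N Dser (xDfin N).
Proof.
rewrite Dfin_eser => i; rewrite fps_coefD fps_coefN fps_coef1 /=.
case: i => [|[|i]] /=.
- by rewrite tbracket0 talg0 elemf0 !subr0 mulr1.
- have -> : talg (tbracket 1) = 1 by rewrite /tbracket big_ord1 talgXn expr0.
  by rewrite !subrr mul0r.
rewrite one_sub_tbracket talgN_scale add0r -sub0r -[X in eq_upto _ _ X]sub0r.
by apply: eq_uptoB => //; apply/eq_uptoZ/elemsym_eq_upto.
Qed.

Lemma fps_from2_eq_upto N (c : nat -> {poly int}) : c 0 = 0 -> c 1 = 0 ->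
  fps_eq_upto N (fps_from 2 (fun i => c i *: elemsym i))
    (xeser N (fun i => talg (c i))).
Proof.
move=> c0 c1 [|[|i]] /=; rewrite ?c0 ?c1 ?talg0 ?mul0r //.
by rewrite mulr_algl; apply/eq_uptoZ/elemsym_eq_upto.
Qed.

Lemma fps_from1_eq_upto N (W : nat -> series) (r : rel nat) :
  (forall n, eq_upto N (W n.+1) (fps_coef (xwrel N r) n.+1)) ->
  fps_eq_upto N (fps_from 1 W) (xwrel N r).
Proof.
move=> Wr [|n]; last exact: Wr.
rewrite /= /wrel fps_coef_sum big1 // => a _.
by rewrite fps_coef_sum big1.
Qed.

(** As [Dser] is a unit, it suffices to compare the products with [Dser] on monomials in finitely
    many variables, where [Dser] agrees with [Dfin]. *)
Lemma solve_Dser (W : nat -> series) (r : rel nat) (Z : {fps series}) :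
  (forall N n, eq_upto N (W n.+1) (fps_coef (xwrel N r) n.+1)) ->
  (forall N, fps_eq_upto N Z (xDfin N * xwrel N r)) ->
  fps_from 1 W = Dser^-1 * Z.
Proof.
move=> Wr Zr; apply: (canRL (mulKr Dser_unit)); apply/fpsP => n.
apply: eq_upto_all => N m Nm; rewrite (Zr N n m Nm).
apply: (fps_eq_uptoM N _ _ _ _ (Dser_eq_upto N) _ n m Nm).
exact: fps_from1_eq_upto.
Qed.

Theorem theorem2p1 :
  [/\ fps_from 1 Wlt = Dser^-1 * fps_from 2 (fun i => a_ i *: elemsym i),
      fps_from 1 Wgt = Dser^-1 * fps_from 2 (fun i => b_ i *: elemsym i)
    & fps_from 1 Weq = Dser^-1 * (fpsC (elemsym 1) * fpsX
                               - fps_from 2 (fun i => c_ i *: elemsym i))].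
Proof.
have tb1 : tbracket 1 = 1 by rewrite /tbracket big_ord1 expr0.
have a1 : a_ 1 = 0 by rewrite a_S a_0 tbracket0 mulr0 addr0.
have b1 : b_ 1 = 0 by rewrite b_S b_0 tbracket0 mulr0 addr0.
split.
- apply: (@solve_Dser _ ltn) => N.
    by move=> n; apply: (words_eq_upto N (fun a b => a < b)%N ltn n).
  by rewrite wrel_lt; apply: fps_from2_eq_upto; rewrite ?a_0.
- apply: (@solve_Dser _ (fun a b => b < a)%N) => N.
    by move=> n; apply: (words_eq_upto N (fun a b => b < a)%N (fun a b => b < a)%N n).
  by rewrite wrel_gt; apply: fps_from2_eq_upto; rewrite ?b_0.
apply: (@solve_Dser _ eq_op) => N.
  move=> n; apply: (words_eq_upto N eq eq_op n) => a b.
  by split=> [[->]|/eqP->].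
rewrite wrel_eq => i; rewrite fps_coefD fps_coefN fps_coefCX.
case: i => [|[|i]] /=.
- by rewrite tbracket0 a_0 b_0 talg0 !subr0 mul0r.
(* In degree 1, [[1]_t - a_1 - b_1 = 1] accounts for [e_1 z]. *)
- rewrite tb1 a1 b1 talg0 !subr0 /talg scale1r mul1r.
  exact: elemsym_eq_upto.
rewrite c_E // (_ : _ - _ - _ = - talg (a_ i.+2 + b_ i.+2 - tbracket i.+2)).
  rewrite talgN_scale -[X in eq_upto _ _ X]sub0r.
  by apply: eq_uptoB => //; apply/eq_uptoZ/elemsym_eq_upto.
by rewrite talgD talgN talgD opprB opprD addrA.
Qed.
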